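(* Let $n\ge 1$ be an integer and let $Y$ be an $n$-digit Benford random variable. Let $d_1\in\{1,\ldots,9\}$ and $d_i\in\{0,1,\ldots,9\}$ for $2\le i\le n$, and put $$x_n=\sum_{j=1}^{n}10^{n-j}d_j = 10^{n-1}d_1+\cdots+d_n .$$ Then $$10^{1-n}\,\log\left(\Big(1+\frac{1}{x_n}\Big)^{x_n}\right)\;\le\;\mathbb{E}\left[S_{d_1\cdots d_n}(Y)\right]\;\le\;10^{1-n}\,\log\left(\Big(1+\frac{1}{x_n}\Big)^{x_n+1}\right).$$
   Context: Throughout, $\log$ denotes the base-10 logarithm and all random variables are positive real valued. Significand: $S:\mathbb{R}^+\to[1,10)$ is defined by $S(x)=10^{\log x-\lfloor\log x\rfloor}$. Significant digits: for $y>0$ and an integer $i\ge1$, $D_i(y)$ is the $i$-th significant decimal digit of $y$, i.e. $D_1(y)=\lfloor S(y)\rfloor\in\{1,\ldots,9\}$ and $D_i(y)=\lfloor 10^{i-1}S(y)\rfloor-10\lfloor 10^{i-2}S(y)\rfloor\in\{0,\ldots,9\}$ for $i\ge 2$. $n$-digit Benford: for a positive integer $n$, a random variable $Y$ is $n$-digit Benford if for all $d_1\in\{1,\ldots,9\}$ and all $d_i\in\{0,1,\ldots,9\}$, $2\le i\le n$, $$P\big(D_1(Y)=d_1,\ldots,D_n(Y)=d_n\big)=\log\bigg(1+\Big(\sum_{j=1}^{n}10^{n-j}d_j\Big)^{-1}\bigg).$$ For $y>0$, $S_{d_1\cdots d_n}(y)=S(y)$ if $D_1(y)=d_1,\ldots,D_n(y)=d_n$,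 and $S_{d_1\cdots d_n}(y)=0$ otherwise. Thus $\mathbb{E}[S_{d_1\cdots d_n}(Y)]$ is the expected value of the significand of $Y$ restricted to the event that the first $n$ significant digits of $Y$ are $d_1,\ldots,d_n$. *)

(* Defs.v *)
From mathcomp Require Import all_boot all_order all_algebra.
From mathcomp Require Import all_classical all_reals all_analysis.

Set Implicit Arguments.
Unset Strict Implicit.
Unset Printing Implicit Defensive.

Import Order.TTheory GRing.Theory Num.Theory.
Local Open Scope classical_set_scope.
Local Open Scope ring_scope.

Definition log10 (R : realType) (x : R) : R := ln x / ln 10.

(* Meaningful for x > 0 only. *)
Definition significand (R : realType) (x : R) : R :=
  10 `^ (log10 x - (Num.floor (log10 x))%:~R).

(* Positions are counted from 1; position 0 is a junk case. *)
Definition sig_digit (R : realType) (i : nat) (y : R) : int :=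
  if (i <= 1)%N then Num.floor (significand y)
  else Num.floor (10 ^+ (i - 1) * significand y)
       - 10 * Num.floor (10 ^+ (i - 2) * significand y).

(* A digit string of length n is a sequence d of which only the values at
   1, ..., n are relevant; its leading digit is nonzero. *)
Definition digit_string (n : nat) (d : nat -> nat) : Prop :=
  (1 <= d 1 <= 9)%N /\ forall i, (2 <= i <= n)%N -> (d i <= 9)%N.

Definition digits_value (n : nat) (d : nat -> nat) : nat :=
  (\sum_(1 <= j < n.+1) 10 ^ (n - j) * d j)%N.

Definition starts_with (R : realType) (n : nat) (d : nat -> nat) (y : R) :
    Prop :=
  forall i, (1 <= i <= n)%N -> sig_digit i y = (d i)%:Z.

Definition restricted_significand (R : realType) (n : nat) (d : nat -> nat)
    (y : R) : R :=
  if `[< starts_with n d y >] then significand y else 0.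

Definition n_digit_benford (disp : measure_display) (T : measurableType disp)
    (R : realType) (P : probability T R) (n : nat) (Y : {RV P >-> R}) : Prop :=
  forall d : nat -> nat, digit_string n d ->
    P [set w | starts_with n d (Y w)] =
      (log10 (1 + (digits_value n d)%:R^-1))%:E.

(* Main.v *)
Require Import Defs.
From mathcomp Require Import all_boot all_order all_algebra.
From mathcomp Require Import all_classical all_reals all_analysis.
From mathcomp Require Import measurable_realfun.

Set Implicit Arguments.
Unset Strict Implicit.
Unset Printing Implicit Defensive.

Import Order.TTheory GRing.Theory Num.Theory.
Local Open Scope classical_set_scope.
Local Open Scope ring_scope.

(** Let [x] be the integer with digits [d 1 .. d n], and let [A] be the event
    that [Y] starts with these digits.  Reading off [n] digits of a significand
    amounts to truncating it, so on [A] the integer part of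
    [10 ^ (n - 1) * S(Y)] is exactly [x] ([starts_with_floor]); hence [S(Y)]
    lies between the constants [10 ^ (1 - n) * x] and [10 ^ (1 - n) * (x + 1)]
    there ([starts_with_significand_bounds]).  Outside [A] the restricted
    significand vanishes, so its expectation is the integral of [S(Y)] over [A]
    ([expectation_restricted_significand]) and lies between those constants
    multiplied by [P A].  The Benford hypothesis gives
    [P A = log10 (1 + 1 / x)], and the factors [x] and [x + 1] become exponents
    inside the logarithm. *)

Lemma digits_valueS (n : nat) (d : nat -> nat) :
  digits_value n.+1 d = (10 * digits_value n d + d n.+1)%N.
Proof.
rewrite /digits_value big_nat_recr //= subnn expn0 mul1n; congr addn.
rewrite big_distrr /=; apply: eq_big_nat => j /andP[_ ltjn].
by rewrite subSn // expnS mulnA.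
Qed.

Lemma digits_value1 (d : nat -> nat) : digits_value 1 d = d 1.
Proof. by rewrite /digits_value big_nat1 subnn expn0 mul1n. Qed.

Lemma significand_ge0 (R : realType) (y : R) : 0 <= significand y.
Proof. exact: powR_ge0. Qed.

(** The definition of the digits telescopes: the [i]-th digit is what turns
    ten times one truncation of the significand into the next one, which is the
    recursion satisfied by the value of a digit string. *)
Lemma starts_with_floor (R : realType) (m : nat) (d : nat -> nat) (y : R) :
  starts_with m.+1 d y ->
  Num.floor (10 ^+ m * significand y) = (digits_value m.+1 d)%:Z.
Proof.
elim: m => [|m IHm] dy.
  by rewrite expr0 mul1r digits_value1; exact: (dy 1%N isT).
have {}IHm : Num.floor (10 ^+ m * significand y) = (digits_value m.+1 d)%:Z.
  by apply: IHm => i /andP[i1 im]; apply: dy; rewrite i1 (leq_trans im).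
have := dy m.+2; rewrite !leqnn /= => /(_ isT).
rewrite /sig_digit /= !subSS !subn0 IHm => /(canRL (subrK _)) ->.
by rewrite addrC [in RHS]digits_valueS PoszD PoszM.
Qed.

Lemma starts_with_significand_bounds (R : realType) (m : nat)
    (d : nat -> nat) (y : R) : starts_with m.+1 d y ->
  10 ^- m * (digits_value m.+1 d)%:R <= significand y
    <= 10 ^- m * (digits_value m.+1 d).+1%:R.
Proof.
move=> /starts_with_floor eq_floor.
have p10 : 0 < (10 : R) ^+ m by rewrite exprn_gt0.
have := floor_itv (10 ^+ m * significand y).
rewrite eq_floor intrD -!pmulrn natr1 => /andP[le_x /ltW x_le].
by rewrite ler_pdivrMl // ler_pdivlMl // le_x x_le.
Qed.

Lemma measurable_floor (R : realType) :
  measurable_fun setT (fun x : R => (Num.floor x)%:~R : R).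
Proof.
by apply: nondecreasing_measurable => // x y le_xy; rewrite ler_int le_floor.
Qed.

Lemma measurable_log10 (R : realType) : measurable_fun setT (@log10 R).
Proof. by apply: measurable_funM => //; exact: measurable_ln. Qed.

Lemma measurable_significand (R : realType) : measurable_fun setT (@significand R).
Proof.
apply: (measurableT_comp (measurable_powRr (10 : R))).
apply: measurable_funB; first exact: measurable_log10.
exact: (measurableT_comp (@measurable_floor R) (@measurable_log10 R)).
Qed.

(** Cast to the reals, a digit is a combination of monotone functions of the
    significand, and the closure of Borel functions under arithmetic applies. *)
Lemma measurable_sig_digit (R : realType) (i : nat) :
  measurable_fun setT (fun y : R => (sig_digit i y)%:~R : R).
Proof.
have mfloor k : measurable_fun setT
    (fun y : R => (Num.floor (10 ^+ k * significand y))%:~R : R).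
  apply: (measurableT_comp (@measurable_floor R)).
  by apply: measurable_funM => //; exact: measurable_significand.
rewrite /sig_digit; case: (i <= 1)%N.
  exact: (measurableT_comp (@measurable_floor R) (@measurable_significand R)).
under eq_fun do rewrite intrB intrM.
by apply: measurable_funB; last apply: measurable_funM.
Qed.

Lemma measurable_starts_with (R : realType) (n : nat) (d : nat -> nat) :
  measurable [set y : R | starts_with n d y].
Proof.
have -> : [set y : R | starts_with n d y] =
    \bigcap_(i in [set i | (1 <= i <= n)%N])
      ((fun y : R => (sig_digit i y)%:~R : R) @^-1` [set (d i)%:R]).
  apply/seteqP; split=> y dy i /= /dy; first by move->.
  by rewrite pmulrn => /intr_inj.
apply: bigcap_measurableType => i _; rewrite -[X in measurable X]setTI.
exact: measurable_sig_digit.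
Qed.

(** Integrating over the event, rather than over the whole space, lets the
    significand be compared with constants. *)
Lemma expectation_restricted_significand (disp : measure_display)
    (T : measurableType disp) (R : realType) (P : probability T R)
    (Y : T -> R) (n : nat) (d : nat -> nat) :
  ('E_P[restricted_significand n d \o Y] =
   \int[P]_(w in [set w | starts_with n d (Y w)]) (significand (Y w))%:E)%E.
Proof.
rewrite unlock [RHS]integral_mkcond; apply: eq_integral => w _.
rewrite patchE /restricted_significand /=.
by case: asboolP => dY; [rewrite mem_set | rewrite memNset].
Qed.

Lemma log10Xn (R : realType) (u : R) (k : nat) : 0 < u ->
  log10 (u ^+ k) = k%:R * log10 u.
Proof. by move=> u0; rewrite /log10 lnXn // mulr_natl mulrnAl. Qed.

Theorem theorem4p2 (disp : measure_display) (T : measurableType disp)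
    (R : realType) (P : probability T R) (n : nat) (hn : (1 <= n)%N)
    (Y : {RV P >-> R}) (Ypos : forall w, 0 < Y w)
    (hY : n_digit_benford n Y)
    (d : nat -> nat) (hd : digit_string n d) :
  let x := digits_value n d in
  (((10 : R) ^ (1 - n%:Z) * log10 ((1 + x%:R^-1) ^+ x))%:E
     <= 'E_P[restricted_significand n d \o Y])%E /\
  ('E_P[restricted_significand n d \o Y]
     <= ((10 : R) ^ (1 - n%:Z) * log10 ((1 + x%:R^-1) ^+ x.+1))%:E)%E.
Proof.
case: n => [//|m] in hn hY hd * => x.
have -> : (10 : R) ^ (1 - m.+1%:Z) = 10 ^- m.
  by rewrite -[m.+1]add1n PoszD opprD addrA subrr sub0r -exprnN.
have u_gt0 : 0 < 1 + x%:R^-1 :> R by rewrite ltr_wpDr // invr_ge0.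
rewrite !log10Xn // ![_ * (_%:R * _)]mulrA expectation_restricted_significand.
set A := [set w | _].
have mY : measurable_fun setT Y by exact: measurable_funPT.
have mA : measurable A.
  rewrite -[A]setTI; apply: mY => //; exact: measurable_starts_with.
have mS : measurable_fun A (fun w => (significand (Y w))%:E).
  apply/measurable_EFinP; apply: measurable_funTS.
  exact: measurableT_comp (@measurable_significand R) mY.
(* Multiplying by the Benford probability is integrating a constant over A. *)
have intA (c : R) :
    (c * log10 (1 + x%:R^-1))%:E = (\int[P]_(w in A) cst c%:E w)%E.
  by rewrite integral_cst // EFinM; congr (_ * _)%E; rewrite -hY.
rewrite !intA; split; apply: ge0_le_integral => //= w Aw; rewrite lee_fin.
- by case/andP: (starts_with_significand_bounds Aw).
- exact: significand_ge0.
- by case/andP: (starts_with_significand_bounds Aw).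
Qed.
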